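(* For a positive integer $t$: (1) $|W_{2t}|=\dfrac1t\displaystyle\sum_{j=1}^{t}2^{\gcd(j,t)}$; (2) $|W_{2t}|\sim\dfrac{2^t}{t}$ as $t\to\infty$; (3) $|W_{\le 2t}|\sim\dfrac{2^{t+1}}{t}$ as $t\to\infty$.
   Context: $G=\mathbb{Z}_2*\mathbb{Z}_3$, where $a$ generates $\mathbb{Z}_2$ and $b$ generates $\mathbb{Z}_3$. The word length $\|g\|$ of $g\in G$ is the minimum length of a word in $\{a,b,b^{-1}\}$ representing $g$; the length of a conjugacy class is $\|[g]\|=\min\{\|h\|:h\in[g]\}$. $W$ is the set of all conjugacy classes of $G$; $W_{n}$ and $W_{\le n}$ are the sets of conjugacy classes of length $n$, respectively at most $n$. $f\sim g$ means $f(t)/g(t)\to1$. *)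

(* Defs.v *)
From HB Require Import structures.
From mathcomp Require Import all_boot all_order all_fingroup all_algebra.
From mathcomp Require Import generic_quotient finmap.
From mathcomp Require Import all_classical all_reals all_analysis.
Import numFieldNormedType.Exports.

Set Implicit Arguments.
Unset Strict Implicit.
Unset Printing Implicit Defensive.

Import Order.TTheory GRing.Theory Num.Theory.

Local Open Scope quotient_scope.
Local Open Scope classical_set_scope.

Section FreeProduct.
Variables H K : groupType.
Local Open Scope group_scope.

Definition fp_word : Type := seq (H + K).

(* The congruence on the monoid of words in the letters of H and K generated by
   the multiplication tables of H and K; its quotient is H * K. *)
Inductive fp_cong : fp_word -> fp_word -> Prop :=
| fp_refl u : fp_cong u u
| fp_sym u v : fp_cong u v -> fp_cong v u
| fp_trans u v w : fp_cong u v -> fp_cong v w -> fp_cong u w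
| fp_cat u u' v v' : fp_cong u u' -> fp_cong v v' -> fp_cong (u ++ v) (u' ++ v')
| fp_one_l : fp_cong [:: inl 1] [::]
| fp_one_r : fp_cong [:: inr 1] [::]
| fp_mul_l x y : fp_cong [:: inl x; inl y] [:: inl (x * y)]
| fp_mul_r x y : fp_cong [:: inr x; inr y] [:: inr (x * y)].

Definition fp_rel : rel fp_word := fun u v => `[< fp_cong u v >].

Lemma fp_rel_equiv : equiv_class_of fp_rel.
Proof.
split=> [u|u v|v u w].
- exact/asboolP/fp_refl.
- by apply/idP/idP => /asboolP h; apply/asboolP/fp_sym.
- by move=> /asboolP h1 /asboolP h2; apply/asboolP/(fp_trans h1 h2).
Qed.

Canonical fp_equiv := EquivRelPack fp_rel_equiv.

Definition free_product : Type := {eq_quot fp_equiv}.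

HB.instance Definition _ := Choice.on free_product.
HB.instance Definition _ := EqQuotient.on free_product.

Definition fp_pi (u : fp_word) : free_product := \pi u.

Lemma fp_piP (u v : fp_word) : fp_pi u = fp_pi v <-> fp_cong u v.
Proof.
split=> [/eqmodP /asboolP //|h]; exact/eqmodP/asboolP.
Qed.

Definition fp_letterV (l : H + K) : H + K :=
  match l with inl x => inl x^-1 | inr y => inr y^-1 end.

Definition fp_wordV (u : fp_word) : fp_word := rev (map fp_letterV u).

Definition fp_mul (p q : free_product) : free_product :=
  fp_pi (repr p ++ repr q).
Definition fp_one : free_product := fp_pi [::].
Definition fp_inv (p : free_product) : free_product := fp_pi (fp_wordV (repr p)).

Lemma fp_reprK (p : free_product) : fp_pi (repr p) = p.
Proof. exact: reprK. Qed.

Lemma fp_repr_cong (u : fp_word) : fp_cong (repr (fp_pi u)) u.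
Proof. by apply/fp_piP; rewrite fp_reprK. Qed.

Lemma fp_mulE u v : fp_mul (fp_pi u) (fp_pi v) = fp_pi (u ++ v).
Proof. by apply/fp_piP; apply: fp_cat; apply: fp_repr_cong. Qed.

Lemma fp_wordV_cat u v : fp_wordV (u ++ v) = fp_wordV v ++ fp_wordV u.
Proof. by rewrite /fp_wordV map_cat rev_cat. Qed.

Lemma fp_letterVK (l : H + K) :
  fp_cong [:: fp_letterV l; l] [::] /\ fp_cong [:: l; fp_letterV l] [::].
Proof.
case: l => x /=; split.
- by apply: fp_trans (fp_mul_l _ _) _; rewrite mulVg; exact: fp_one_l.
- by apply: fp_trans (fp_mul_l _ _) _; rewrite mulgV; exact: fp_one_l.
- by apply: fp_trans (fp_mul_r _ _) _; rewrite mulVg; exact: fp_one_r.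
- by apply: fp_trans (fp_mul_r _ _) _; rewrite mulgV; exact: fp_one_r.
Qed.

Lemma fp_wordVK u : fp_cong (fp_wordV u ++ u) [::].
Proof.
elim: u => [|l u IH]; first exact: fp_refl.
rewrite -cat1s fp_wordV_cat -catA; apply: fp_trans IH.
apply: fp_cat; first exact: fp_refl.
rewrite catA -[X in fp_cong _ X]cat0s; apply: fp_cat; last exact: fp_refl.
exact: (fp_letterVK l).1.
Qed.

Lemma fp_wordKV u : fp_cong (u ++ fp_wordV u) [::].
Proof.
elim: u => [|l u IH]; first exact: fp_refl.
rewrite -cat1s fp_wordV_cat -catA [u ++ _]catA.
apply: fp_trans (fp_letterVK l).2.
rewrite -[[:: l; _]]/([:: l] ++ ([::] ++ [:: fp_letterV l])).
by do 2?[apply: fp_cat; try exact: fp_refl].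
Qed.

Lemma fp_mulA : associative fp_mul.
Proof.
by move=> p q r; rewrite -(fp_reprK p) -(fp_reprK q) -(fp_reprK r) !fp_mulE catA.
Qed.

Lemma fp_mul1 : left_id fp_one fp_mul.
Proof. by move=> p; rewrite -(fp_reprK p) fp_mulE. Qed.

Lemma fp_mulp1 : right_id fp_one fp_mul.
Proof. by move=> p; rewrite -(fp_reprK p) fp_mulE cats0. Qed.

Lemma fp_mulV : left_inverse fp_one fp_inv fp_mul.
Proof.
by move=> p; rewrite -{2}(fp_reprK p) fp_mulE; apply/fp_piP/fp_wordVK.
Qed.

Lemma fp_mulpV : right_inverse fp_one fp_inv fp_mul.
Proof.
by move=> p; rewrite -{1}(fp_reprK p) fp_mulE; apply/fp_piP/fp_wordKV.
Qed.

HB.instance Definition _ := isGroup.Build free_product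
  fp_mulA fp_mul1 fp_mulp1 fp_mulV fp_mulpV.

Definition fp_inl (x : H) : free_product := fp_pi [:: inl x].
Definition fp_inr (y : K) : free_product := fp_pi [:: inr y].

End FreeProduct.

(* As groups, 'Z_2 and 'Z_3 carry the addition of residues, so the residue 1
   generates them. *)
Definition G : groupType := free_product 'Z_2 'Z_3.
Definition gen_a : G := fp_inl 'Z_3 (1%R : 'Z_2).
Definition gen_b : G := fp_inr 'Z_2 (1%R : 'Z_3).

Definition is_word (w : seq G) : bool :=
  all (mem [:: gen_a; gen_b; gen_b^-1%g]) w.
Definition word_value (w : seq G) : G := (\prod_(x <- w) x)%g.

(* The least element of A, and 0 when A is empty. *)
Definition min_nat (A : set nat) : nat :=
  xget 0%N [set n | A n /\ forall m, A m -> (n <= m)%N].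

Lemma min_natP (A : set nat) :
  A !=set0 -> A (min_nat A) /\ forall m, A m -> (min_nat A <= m)%N.
Proof.
move=> [n An].
have exA : exists n, `[< A n >] by exists n; apply/asboolP.
have [m /asboolP Am mmin] := ex_minnP exA.
apply: (@xgetPex _ 0%N [set n | A n /\ forall m, A m -> (n <= m)%N]).
by exists m; split=> // k Ak; apply/mmin/asboolP.
Qed.

Definition word_lengths (g : G) : set nat :=
  [set n | exists w : seq G, [/\ is_word w, word_value w = g & size w = n]].

Definition word_length (g : G) : nat := min_nat (word_lengths g).

Lemma word_lengths_neq0 (g : G) : word_lengths g !=set0.
Proof.
suff [w ww wg] : exists2 w, is_word w & word_value w = g.
  by exists (size w), w.
rewrite -(fp_reprK g); elim: (repr g) => [|l u [w ww wu]].
  by exists [::] => //; rewrite /word_value big_nil.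
have -> : fp_pi (l :: u) = (fp_pi [:: l] * fp_pi u)%g.
  by rewrite -cat1s -fp_mulE.
suff [v vv <-] : exists2 v, is_word v & word_value v = fp_pi [:: l].
  exists (v ++ w); first by rewrite /is_word all_cat; apply/andP.
  by rewrite /word_value big_cat /= -/(word_value v) -wu.
have [ga gb] : is_word [:: gen_a] /\ is_word [:: gen_b].
  by rewrite /is_word /= !inE !eqxx !orbT.
case: l => x.
- case: (eqVneq x 0%R) => [->|x0].
    exists [::] => //; rewrite /word_value big_nil.
    by apply/fp_piP/fp_sym; exact: fp_one_l.
  exists [:: gen_a] => //; rewrite /word_value big_seq1.
  suff -> : x = 1%R by [].
  by case: x x0 => [[|[|[]]] //= i] _; apply: val_inj.
- case: (eqVneq x 0%R) => [->|x0].
    exists [::] => //; rewrite /word_value big_nil.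
    by apply/fp_piP/fp_sym; exact: fp_one_r.
  case: (eqVneq x 1%R) => [->|x1].
    by exists [:: gen_b] => //; rewrite /word_value big_seq1.
  exists [:: gen_b; gen_b]; first by rewrite /is_word /= !inE !eqxx !orbT.
  rewrite /word_value big_cons big_seq1 -[LHS]/(fp_mul gen_b gen_b) fp_mulE.
  apply/fp_piP; apply: fp_trans (fp_mul_r _ _ _) _.
  suff -> : x = (1 + 1)%R :> 'Z_3 by exact: fp_refl.
  by case: x x0 x1 => [[|[|[|[]]]] //= i] _ _; apply: val_inj.
Qed.

Definition conj_class (g : G) : set G := [set (g ^ x)%g | x in [set: G]].

Definition class_length (c : set G) : nat := min_nat (word_length @` c).

Definition W : set (set G) := range conj_class.
Definition W_eq (n : nat) : set (set G) := [set c | W c /\ class_length c = n].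
Definition W_le (n : nat) : set (set G) :=
  [set c | W c /\ (class_length c <= n)%N].

(* fset_set sends an infinite set to fset0, so this is the cardinality of a
   finite set, and 0 for an infinite one. *)
Definition set_card (T : choiceType) (A : set T) : nat := #|` fset_set A |.

Definition asymp_equiv (R : realType) (f g : R^nat) : Prop :=
  (f t / g t)%R @[t --> \oo] --> (1 : R)%R.

(* Main.v *)
(* The group acts on infinite reduced words b^o a b^(s 0) a b^(s 1) a ..., each
   carrying an integer that counts the letters b^(+-1) gained or lost at the
   front.  The element P(e) = a b^(e 0) ... a b^(e (n-1)) fixes the periodic word
   e^oo up to raising the counter by n.  Hence a conjugate of P(e) raises the
   counter of some word by n, while each generator changes the height (twice the
   counter, plus one if the word starts with b^(+-1)) by at most one; so the class
   of P(e) has length 2n.  If x P(f) x^-1 = P(e), then x f^oo is fixed by P(e) with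
   a positive raise, which forces it to be e^oo; as x preserves tails, e is a
   rotation of f.  Every class of length at least 2 contains some P(e), so the
   classes of length 2t are the binary necklaces of length t, which Burnside's
   lemma counts.  In that count the terms with j < t contribute at most
   t 2^(t/2), which gives (2).  For (3), the ratio r(t) of the two sides satisfies
   r(t+1) = r(t) (t+1)/(2t) + q(t+1)/2 with q(t) = 1 + O(1/t) the ratio in (2), so
   r(t) = 1 + O(1/t). *)
Require Import Defs.
From mathcomp Require Import all_boot all_order all_fingroup all_algebra.
From mathcomp Require Import finmap zify ring lra.
From mathcomp Require Import all_classical all_reals all_analysis.
Import numFieldNormedType.Exports.
Import Order.TTheory GRing.Theory Num.Theory.

Local Open Scope ring_scope.

(** * The action on infinite reduced words *)

(* (o, k, s) stands for the word b^o a b^(s 0) a b^(s 1) ..., where true is b,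
   false is b^-1 and o = None means that the word starts with a; k is the
   counter. *)
Definition ray : Type := (option bool * int * (nat -> bool))%type.

Definition scons (d : bool) (s : nat -> bool) (i : nat) : bool :=
  if i is j.+1 then s j else d.

Definition stail (s : nat -> bool) (i : nat) : bool := s i.+1.

Lemma scons_stail s : scons (s 0%N) (stail s) = s.
Proof. by apply/funext; case. Qed.

(** Left multiplication by [a]. The counter moves only here, when a letter b^(+-1) enters or leaves
    [s], so that [ray_a] is an involution and [ray_b] has order 3. *)
Definition ray_a (y : ray) : ray :=
  let: (o, k, s) := y in
  if o is Some d then (None, k + 1, scons d s)
  else (Some (s 0%N), k - 1, stail s).

Definition ray_b (y : ray) : ray :=
  let: (o, k, s) := y in
  (match o with
   | None => Some true | Some true => Some false | Some false => None
   end, k, s).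

Lemma ray_aK : involutive ray_a.
Proof.
by move=> [[[d|] k] s] /=; rewrite ?scons_stail ?addrK ?subrK.
Qed.

Lemma ray_b3 y : ray_b (ray_b (ray_b y)) = y.
Proof. by case: y => [[[[]|] k] s]. Qed.

Lemma iter_modn (T : Type) (f : T -> T) n m :
  (forall y, iter n f y = y) -> iter (m %% n) f =1 iter m f.
Proof.
move=> fn y; rewrite {2}(divn_eq m n) iterD.
by elim: (m %/ n)%N => [|q IH] //; rewrite mulSn iterD fn.
Qed.

Definition ray_letter (l : 'Z_2 + 'Z_3) : ray -> ray :=
  match l with inl x => iter x ray_a | inr x => iter x ray_b end.

Definition ray_word (u : fp_word 'Z_2 'Z_3) (y : ray) : ray :=
  foldr ray_letter y u.

Lemma ray_word_cat u v y : ray_word (u ++ v) y = ray_word u (ray_word v y).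
Proof. exact: foldr_cat. Qed.

(** Makes the action well defined on [G]. Beyond the closure rules only the multiplication tables
    matter, and they hold since the two maps have orders 2 and 3. *)
Lemma ray_word_cong (u v : fp_word 'Z_2 'Z_3) : fp_cong u v -> ray_word u =1 ray_word v.
Proof.
elim=> {u v} //.
- by move=> u v _ IH y.
- by move=> u v w _ IH1 _ IH2 y; rewrite IH1.
- by move=> u u' v v' _ IH1 _ IH2 y; rewrite !ray_word_cat IH1 IH2.
- move=> x x' y /=; rewrite -iterD -[RHS]/(iter ((x + x') %% 2) ray_a y).
  by rewrite iter_modn // => z; exact: ray_aK.
- move=> x x' y /=; rewrite -iterD -[RHS]/(iter ((x + x') %% 3) ray_b y).
  by rewrite iter_modn // => z; exact: ray_b3.
Qed.

Definition ray_act (g : G) : ray -> ray := ray_word (generic_quotient.repr g).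

Lemma ray_act_pi (u : fp_word 'Z_2 'Z_3) : ray_act (fp_pi u) =1 ray_word u.
Proof. exact/ray_word_cong/fp_repr_cong. Qed.

Lemma ray_actM (g h : G) y : ray_act (g * h)%g y = ray_act g (ray_act h y).
Proof.
by rewrite -[(g * h)%g]/(fp_mul g h) /fp_mul ray_act_pi ray_word_cat.
Qed.

Lemma ray_act1 y : ray_act 1%g y = y.
Proof. by rewrite -[1%g]/(fp_one _ _) ray_act_pi. Qed.

Lemma ray_act_a y : ray_act gen_a y = ray_a y.
Proof. by rewrite ray_act_pi. Qed.

Lemma ray_act_b y : ray_act gen_b y = ray_b y.
Proof. by rewrite ray_act_pi. Qed.

(** * Relations in G and the products P(e) *)

Lemma gen_aa : (gen_a * gen_a = 1)%g.
Proof.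
rewrite -[LHS]/(fp_mul _ _) fp_mulE; apply/fp_piP.
apply: fp_trans (fp_mul_l _ _ _) _.
suff -> : ((1%R : 'Z_2) * (1%R : 'Z_2) = 1)%g by exact: fp_one_l.
exact/val_inj.
Qed.

Lemma gen_bb : (gen_b * gen_b = gen_b^-1)%g.
Proof.
apply: (mulIg gen_b); rewrite mulVg.
have -> : (gen_b * gen_b)%g = fp_inr 'Z_2 (1%R + 1%R : 'Z_3).
  rewrite -[LHS]/(fp_mul _ _) fp_mulE; apply/fp_piP; exact: fp_mul_r.
rewrite -[LHS]/(fp_mul _ _) fp_mulE; apply/fp_piP.
apply: fp_trans (fp_mul_r _ _ _) _.
suff -> : ((1%R + 1%R : 'Z_3) * (1%R : 'Z_3) = 1)%g by exact: fp_one_r.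
exact/val_inj.
Qed.

Definition gen_bsign (d : bool) : G := if d then gen_b else gen_b^-1%g.

Lemma gen_bsignN d : (gen_bsign (~~ d) = (gen_bsign d)^-1)%g.
Proof. by case: d => //=; rewrite invgK. Qed.

Lemma gen_bsignD d : (gen_bsign d * gen_bsign d = gen_bsign (~~ d))%g.
Proof.
by case: d; rewrite /= -?invMg gen_bb ?invgK.
Qed.

Lemma ray_act_bsign d k s : ray_act (gen_bsign d) (None, k, s) = (Some d, k, s).
Proof.
case: d => /=; rewrite ?ray_act_b //.
by rewrite -gen_bb ray_actM !ray_act_b.
Qed.

Lemma ray_act_bsign_some d e k s :
  ray_act (gen_bsign d) (Some e, k, s) = (if d == e then Some (~~ d) else None, k, s).
Proof.
case: d => /=; rewrite -?gen_bb ?ray_actM !ray_act_b; by case: e.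
Qed.

Definition ab_word (e : seq bool) : G := (\prod_(d <- e) (gen_a * gen_bsign d))%g.

Lemma ab_word0 : ab_word [::] = 1%g.
Proof. exact: big_nil. Qed.

Lemma ab_word1 d : ab_word [:: d] = (gen_a * gen_bsign d)%g.
Proof. exact: big_seq1. Qed.

Lemma ab_word_cons d e : ab_word (d :: e) = (gen_a * gen_bsign d * ab_word e)%g.
Proof. exact: big_cons. Qed.

Lemma ab_word_cat e f : ab_word (e ++ f) = (ab_word e * ab_word f)%g.
Proof. exact: big_cat. Qed.

Lemma ab_word_rcons d e : ab_word (rcons e d) = (ab_word e * (gen_a * gen_bsign d))%g.
Proof. by rewrite -cats1 ab_word_cat ab_word1. Qed.

Definition prepend (e : seq bool) (s : nat -> bool) : nat -> bool :=
  foldr scons s e.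

(** Nothing cancels in front of a word that starts with [a], so each factor adds one letter and
    raises the counter by one. *)
Lemma ray_act_ab_word e k s :
  ray_act (ab_word e) (None, k, s) = (None, k + (size e)%:Z, prepend e s).
Proof.
elim: e => [|d e IH]; first by rewrite ab_word0 ray_act1 /= addr0.
rewrite ab_word_cons !ray_actM IH ray_act_bsign ray_act_a /=.
by congr (_, _, _); lia.
Qed.

Definition ray_raise (m : int) (y : ray) : ray :=
  let: (o, k, s) := y in (o, k + m, s).

Lemma ray_a_raise m y : ray_a (ray_raise m y) = ray_raise m (ray_a y).
Proof. by case: y => [[[d|] k] s] /=; congr (_, _, _); lia. Qed.

Lemma ray_b_raise m y : ray_b (ray_raise m y) = ray_raise m (ray_b y).
Proof. by case: y => [[[[]|] k] s]. Qed.

(** No generator reads the counter. Hence a raise at one word carries over to conjugates. *)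
Lemma ray_act_raise g m y : ray_act g (ray_raise m y) = ray_raise m (ray_act g y).
Proof.
rewrite /ray_act; elim: (generic_quotient.repr g) => //= l u ->.
by case: l => x /=; elim: (x : nat) => //= n ->; rewrite ?ray_a_raise ?ray_b_raise.
Qed.

(** Equality of tails up to a shift. The offsets [i] and [j] are separate because [ray_a] adds or
    drops a letter. *)
Definition cotail (y z : ray) : Prop :=
  exists i j, forall m, y.2 (i + m)%N = z.2 (j + m)%N.

Lemma cotail_refl y : cotail y y.
Proof. by exists 0%N, 0%N. Qed.

Lemma cotail_trans x y z : cotail x y -> cotail y z -> cotail x z.
Proof.
move=> [i [j xy]] [i' [j' yz]]; exists (i + i')%N, (j' + j)%N => m.
by rewrite -addnA xy addnCA yz addnA.
Qed.

Lemma cotail_iter f n y : (forall z, cotail (f z) z) -> cotail (iter n f y) y.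
Proof.
by move=> fz; elim: n => [|n IH]; [exact: cotail_refl|exact: cotail_trans (fz _) IH].
Qed.

Lemma cotail_a y : cotail (ray_a y) y.
Proof.
case: y => [[[d|] k] s]; first by exists 1%N, 0%N.
by exists 0%N, 1%N.
Qed.

Lemma cotail_b y : cotail (ray_b y) y.
Proof. by case: y => [[c k] s]; exists 0%N, 0%N. Qed.

Lemma cotail_act g y : cotail (ray_act g y) y.
Proof.
rewrite /ray_act; elim: (generic_quotient.repr g) => [|l u IH] /=.
  exact: cotail_refl.
apply: cotail_trans IH.
by case: l => x; apply: cotail_iter; [exact: cotail_a|exact: cotail_b].
Qed.

(** The weight 2 makes [ray_a] change the height by exactly one: the counter contributes 2 and the
    new front takes 1 back. *)
Definition ray_height (y : ray) : int := y.1.2 *+ 2 + (y.1.1 != None)%:Z.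

Lemma ray_height_raise m y : ray_height (ray_raise m y) = ray_height y + m *+ 2.
Proof. by case: y => [[c k] s]; rewrite /ray_height /=; lia. Qed.

Lemma ray_height_word w y : is_word w ->
  ray_height (ray_act (word_value w) y) <= ray_height y + (size w)%:Z.
Proof.
elim: w => [|x w IH] /=; first by rewrite /word_value big_nil ray_act1 addr0.
case/andP=> xin /IH {IH}.
rewrite /word_value big_cons ray_actM; case: (ray_act _ _) => [[c k] s] le.
suff : ray_height (ray_act x (c, k, s)) <= ray_height (c, k, s) + 1.
  by move/le_trans; apply; rewrite -[(size w).+1]addn1 PoszD addrA lerD2r.
move: xin; rewrite !inE => /or3P[] /eqP->.
- by rewrite ray_act_a; case: c {le} => [d|]; rewrite /ray_height /=; lia.
- by rewrite ray_act_b; case: c {le} => [[]|]; rewrite /ray_height /=; lia.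
- by rewrite -gen_bb ray_actM !ray_act_b; case: c {le} => [[]|];
    rewrite /ray_height /=; lia.
Qed.

(** * Periodic words fixed by P(e) *)

Definition repeat_seq (e : seq bool) (i : nat) : bool := nth true e (i %% size e).

Lemma prependE e s i :
  prepend e s i = if (i < size e)%N then nth true e i else s (i - size e)%N.
Proof. by elim: e i => [|d e IH] [|i] //=; rewrite IH ltnS subSS. Qed.

Lemma prepend_repeat e : (0 < size e)%N -> prepend e (repeat_seq e) = repeat_seq e.
Proof.
move=> e0; apply/funext => i; rewrite prependE /repeat_seq; case: ltnP => ie.
  by rewrite modn_small.
by rewrite -[in RHS](subnK ie) modnDr.
Qed.

(** Strong induction: the first [size e] letters are those of [e], and every later letter repeats
    the one [size e] places before. *)
Lemma prepend_fixed e s : (0 < size e)%N -> prepend e s = s -> s = repeat_seq e.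
Proof.
move=> e0 es; apply/funext => i; elim/ltn_ind: i => i IH.
rewrite -es prependE; case: ltnP => ie; first by rewrite /repeat_seq modn_small.
by rewrite IH ?ltn_subrL ?e0 ?(leq_trans e0) // /repeat_seq -[in RHS](subnK ie) modnDr.
Qed.

(* A word starting with b^d and fixed by P(e) up to the counter would be its
   repelling fixed point, where the counter decreases. *)
Lemma ray_act_ab_word_some e d k s :
  let y := ray_act (ab_word e) (Some d, k, s) in
  y.1.1 = None \/ y.1.2 = k - (size e)%:Z.
Proof.
elim/last_ind: e d k s => [|e l IH] d k s /=.
  by right; rewrite ab_word0 ray_act1 /= subr0.
rewrite ab_word_rcons !ray_actM ray_act_bsign_some.
case: eqP => _; rewrite ray_act_a /=.
  by left; rewrite ray_act_ab_word.
case: (IH (s 0%N) (k - 1) (stail s)) => /= ->; [by left|right].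
by rewrite size_rcons; lia.
Qed.

(** Here [y] is x f^oo: x^-1 leads back to f^oo, P(f) raises its counter, and the raise commutes
    with [x]. *)
Lemma ab_word_conj_fixed (x : G) f : (0 < size f)%N ->
  let y := ray_act x (None, 0, repeat_seq f) in
  ray_act (x * ab_word f * x^-1)%g y = ray_raise (size f)%:Z y.
Proof.
move=> f0 y; rewrite /y -ray_act_raise -!ray_actM mulgKV ray_actM ray_act_ab_word.
by rewrite prepend_repeat.
Qed.

Lemma nth_rot_mod (T : Type) (x0 : T) (s : seq T) r i : (r <= size s)%N -> (i < size s)%N ->
  nth x0 (rot r s) i = nth x0 s ((i + r) %% size s).
Proof.
move=> rs si; rewrite /rot nth_cat size_drop nth_drop.
case: ltnP => ir; first by rewrite modn_small 1?addnC //; lia.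
have -> : (i + r = (i - (size s - r)) + size s)%N by lia.
by rewrite modnDr modn_small ?nth_take //; lia.
Qed.

Lemma cotail_repeat_rot e f i j : size e = size f -> (0 < size e)%N ->
  (forall m, repeat_seq e (i + m) = repeat_seq f (j + m)) ->
  exists2 r, (r < size f)%N & e = rot r f.
Proof.
(* [size e * i - i] is congruent to -i modulo the period, so this extra shift brings e^oo back to
   its start. *)
move=> ef e0 H; exists ((j + (size e * i - i)) %% size f)%N.
  by rewrite ltn_mod -ef.
have r_lt := ltn_pmod (j + (size e * i - i)) e0.
apply: (@eq_from_nth _ true) => [|m me]; first by rewrite size_rot.
rewrite nth_rot_mod -?ef // ?(ltnW r_lt) // modnDmr ef.
have := H (m + (size e * i - i))%N; rewrite /repeat_seq addnCA [(j + _)%N]addnCA.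
have -> : (m + (i + (size e * i - i)) = i * size e + m)%N by nia.
by rewrite modnMDl modn_small // -ef.
Qed.

Lemma ab_word_conj_rot e f (x : G) : (0 < size e)%N -> (0 < size f)%N ->
  (ab_word e = x * ab_word f * x^-1)%g ->
  size e = size f /\ exists2 r, (r < size f)%N & e = rot r f.
Proof.
move=> e0 f0 ex; have := ab_word_conj_fixed x f f0; rewrite -ex.
have := cotail_act x (None, 0, repeat_seq f).
case: (ray_act x _) => [[[d|] k] s] tl /= fx.
  (* If x f^oo started with b^d, P(e) would make it start with [a] or lower its counter; but it
     keeps its first letter and raises the counter by [size f > 0]. *)
  by have := ray_act_ab_word_some e d k s; rewrite fx /=; case=> //; lia.
move: fx; rewrite ray_act_ab_word => -[kk ss].
have ef : size e = size f by lia.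
split=> //; case: tl => i [j]; rewrite /= (prepend_fixed _ _ e0 ss).
exact: cotail_repeat_rot.
Qed.

(** * Conjugacy classes *)

Lemma conj_classJ g x : conj_class (g ^ x)%g = conj_class g.
Proof.
apply/seteqP; split=> _ [y _ <-].
  by exists (x * y)%g => //; rewrite conjgM.
by exists (x^-1 * y)%g => //; rewrite -conjgM mulKVg.
Qed.

Lemma conj_class_id g : conj_class g g.
Proof. by exists 1%g => //; rewrite conjg1. Qed.

Lemma conj_class_in g h : conj_class g h -> conj_class h = conj_class g.
Proof. by case=> x _ <-; exact: conj_classJ. Qed.

Lemma conj_classC (g h : G) : conj_class (g * h)%g = conj_class (h * g)%g.
Proof. by rewrite -(conj_classJ _ g) conjgE -mulgA mulKg. Qed.

Lemma word_lengthP g :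
  exists2 w, is_word w & word_value w = g /\ size w = word_length g.
Proof.
have [[w [ww wg sw]] _] := min_natP (word_lengths_neq0 g).
by exists w.
Qed.

Lemma class_lengthP g :
  exists2 w, is_word w & conj_class g = conj_class (word_value w) /\
                         size w = class_length (conj_class g).
Proof.
have ne : (word_length @` conj_class g !=set0)%classic.
  by exists (word_length g), g => //; exact: conj_class_id.
have [[h gh hl] _] := min_natP ne.
have [w ww [wh sw]] := word_lengthP h; exists w => //.
by rewrite wh sw hl (conj_class_in _ _ gh).
Qed.

Lemma class_length_le g w : is_word w -> conj_class g (word_value w) ->
  (class_length (conj_class g) <= size w)%N.
Proof.
move=> ww gw.
have ne : (word_length @` conj_class g !=set0)%classic.
  by exists (word_length g), g => //; exact: conj_class_id.
apply: leq_trans ((min_natP ne).2 (word_length (word_value w)) _) _.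
  by exists (word_value w).
apply: (min_natP (word_lengths_neq0 (word_value w))).2.
by exists w.
Qed.

Lemma class_length_ab_word e : (0 < size e)%N ->
  class_length (conj_class (ab_word e)) = (2 * size e)%N.
Proof.
move=> e0; apply/eqP; rewrite eqn_leq; apply/andP; split.
  pose w := flatten [seq [:: gen_a; gen_bsign d] | d <- e].
  have sw : size w = (2 * size e)%N by rewrite /w; elim: (e) => //= d e' ->; lia.
  rewrite -sw; apply: class_length_le.
    rewrite /w; elim: (e) => //= d e' IH; rewrite IH !inE eqxx /=.
    by case: d; rewrite eqxx ?orbT.
  suff -> : word_value w = ab_word e by exact: conj_class_id.
  rewrite /w; elim: (e) => [|d e' IH]; first by rewrite ab_word0 /word_value big_nil.
  rewrite ab_word_cons -IH /word_value -[flatten _]/([:: gen_a; gen_bsign d] ++ _).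
  by rewrite big_cat big_cons big_seq1.
(* Lower bound: a shortest word [w] for the class is a conjugate of P(e), so it raises the height of
   x^-1 e^oo by [2 * size e], and each letter accounts for at most one. *)
have [w ww [ew <-]] := class_lengthP (ab_word e).
have [x _ xw] : conj_class (ab_word e) (word_value w).
  by rewrite ew; exact: conj_class_id.
have := ab_word_conj_fixed x^-1%g e e0; rewrite /= invgK.
rewrite -mulgA -conjgE xw => fx.
have := ray_height_word w (ray_act x^-1%g (None, 0, repeat_seq e)) ww.
rewrite fx ray_height_raise lerD2l.
have -> : (size e)%:Z *+ 2 = (2 * size e)%N by rewrite -mulr_natr; lia.
by rewrite lez_nat.
Qed.

Lemma conj_class_ab_word_rot e r : conj_class (ab_word (rot r e)) = conj_class (ab_word e).
Proof.
by rewrite /rot ab_word_cat conj_classC -ab_word_cat cat_take_drop.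
Qed.

Lemma conj_class_ab_word_eq e f : (0 < size e)%N -> (0 < size f)%N ->
  conj_class (ab_word e) = conj_class (ab_word f) ->
  size e = size f /\ exists2 r, (r < size f)%N & e = rot r f.
Proof.
move=> e0 f0 ef.
have [x _ xe] : conj_class (ab_word f) (ab_word e).
  by rewrite -ef; exact: conj_class_id.
apply: (ab_word_conj_rot e f x^-1%g) => //.
by rewrite invgK -mulgA -conjgE.
Qed.

(** * Normal form and cyclic reduction *)

Definition gen_bopt (o : option bool) : G := if o is Some d then gen_bsign d else 1%g.

Definition gen_aopt (c : bool) : G := if c then gen_a else 1%g.

(** Induction on a word: these products contain 1 and are stable under left multiplication by
    [gen_a] and [gen_b], and the inverse of [gen_b] is its square. *)
Lemma normal_form g :
  exists o e c, g = (gen_bopt o * ab_word e * gen_aopt c)%g.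
Proof.
have aE h : (exists o e c, h = (gen_bopt o * ab_word e * gen_aopt c)%g) ->
    exists o e c, (gen_a * h)%g = (gen_bopt o * ab_word e * gen_aopt c)%g.
  case=> -[d|] [e [c ->]].
    by exists None, (d :: e), c; rewrite ab_word_cons /= mul1g !mulgA.
  case: e => [|d e].
    exists None, [::], (~~ c); rewrite ab_word0 !mul1g.
    by case: c; rewrite /= ?gen_aa ?mulg1.
  exists (Some d), e, c.
  by rewrite ab_word_cons /= mul1g !mulgA gen_aa mul1g.
have bE h : (exists o e c, h = (gen_bopt o * ab_word e * gen_aopt c)%g) ->
    exists o e c, (gen_b * h)%g = (gen_bopt o * ab_word e * gen_aopt c)%g.
  case=> -[[]|] [e [c ->]].
  - by exists (Some false), e, c; rewrite !mulgA /= gen_bb.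
  - by exists None, e, c; rewrite !mulgA /= mulgV.
  - by exists (Some true), e, c; rewrite !mulgA /= mulg1.
have [n [w [ww <- _]]] := word_lengths_neq0 g.
elim: w ww => [_|x w IH] /=.
  exists None, [::], false.
  by rewrite ab_word0 /= !mulg1 /word_value big_nil.
rewrite /word_value big_cons; case/andP=> + /IH {}IH.
rewrite !inE => /or3P[] /eqP->; [exact: aE|exact: bE|].
by rewrite -gen_bb -mulgA; exact/bE/bE.
Qed.

(** Cyclic reduction of the normal form: conjugation moves an end factor to the other side, where it
    completes a factor a b^(+-1), merges or cancels. *)
Lemma conj_class_repr g :
  (exists w, [/\ is_word w, (size w <= 1)%N & conj_class g = conj_class (word_value w)])
  \/ (exists2 e, (0 < size e)%N & conj_class g = conj_class (ab_word e)).
Proof.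
have v0 : word_value [::] = 1%g by exact: big_nil.
have v1 x : word_value [:: x] = x by exact: big_seq1.
have wa : is_word [:: gen_a] by rewrite /is_word /= !inE eqxx.
have wb d : is_word [:: gen_bsign d].
  by rewrite /is_word /= !inE; case: d; rewrite eqxx ?orbT.
have [u [e [c ->]]] := normal_form g.
have [n] := ubnP (size e); elim: n => // n IH in u e c *; rewrite ltnS => en.
case: c => /=; last first.
  rewrite mulg1; case: u => [d|] /=; last first.
    rewrite mul1g; case: e en => [|d e] en; last by right; exists (d :: e).
    by left; exists [::]; rewrite v0 ab_word0.
  case/lastP: e en => [|e l] en.
    by left; exists [:: gen_bsign d]; rewrite v1 ab_word0 mulg1.
  (* The front letter b^d moves behind the last letter b^l. If l = d they merge into the inverse of
     b^d; otherwise they cancel, and a shorter product followed by [a] remains. *)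
  rewrite conj_classC ab_word_rcons -2!mulgA.
  case: (eqVneq l d) => [->|ld].
    right; exists (rcons e (~~ d)); first by rewrite size_rcons.
    by rewrite ab_word_rcons gen_bsignD.
  have -> : l = ~~ d by case: l d ld {en} => [] [].
  rewrite gen_bsignN mulVg mulg1.
  rewrite size_rcons in en.
  by have := IH None e true en; rewrite /= mul1g.
case: u => [d|] /=; last first.
  rewrite mul1g; case: e en => [|d e] en.
    by left; exists [:: gen_a]; rewrite v1 ab_word0 mul1g.
  rewrite conj_classC ab_word_cons !mulgA gen_aa mul1g.
  by have := IH (Some d) e false en; rewrite /= mulg1.
right; exists (d :: e) => //.
by rewrite conj_classC ab_word_cons !mulgA.
Qed.

Lemma W_eq_even t : (0 < t)%N ->
  W_eq (2 * t) = range (fun e : t.-tuple bool => conj_class (ab_word e)).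
Proof.
move=> t0; apply/seteqP; split=> [c [[g _ <-]]|_ [e _ <-]]; last first.
  by split; [exists (ab_word e)|rewrite class_length_ab_word size_tuple].
case: (conj_class_repr g) => [[w [ww w1 ->]]|[e e0 ->]].
  (* A word of length at most one is too short for the length [2 * t]. *)
  by have := class_length_le _ _ ww (conj_class_id _) => + E; rewrite E; lia.
rewrite class_length_ab_word // => et.
have /eqP te : size e = t by lia.
by exists (Tuple te).
Qed.

Lemma W_eq_odd t : (0 < t)%N -> W_eq (2 * t).+1 = classical_sets.set0.
Proof.
move=> t0; apply/seteqP; split=> // c [[g _ <-]].
case: (conj_class_repr g) => [[w [ww w1 ->]]|[e e0 ->]].
  by have := class_length_le _ _ ww (conj_class_id _) => + E; rewrite E; lia.
by rewrite class_length_ab_word //; lia.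
Qed.

(** There are finitely many words of length [n]; indices in ['I_3] code their letters by a finite
    type. Finiteness makes [set_card] a true count. *)
Lemma finite_W_eq n : finite_set (W_eq n).
Proof.
pose letters := [:: gen_a; gen_b; gen_b^-1%g].
pose F (u : n.-tuple 'I_3) := conj_class (word_value [seq nth 1%g letters i | i : 'I_3 <- u]).
apply: (@sub_finite_set _ _ (range F)); last exact: finite_image.
move=> c [[g _ <-] cn].
have [w ww [gw sw]] := class_lengthP g.
pose u := [seq inord (index x letters) : 'I_3 | x <- w].
have un : size u == n by rewrite size_map sw cn.
exists (Tuple un) => //; rewrite gw /F /u /= -map_comp map_id_in // => x xw /=.
have xl : x \in letters by move/allP: ww => /(_ _ xw).
have xi : (index x letters < size letters)%N by rewrite index_mem.
by rewrite inordK ?nth_index.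
Qed.

Lemma W_leS n : W_le n.+1 = (W_le n `|` W_eq n.+1)%classic.
Proof.
apply/seteqP; split=> c.
  case=> Wc; rewrite leq_eqVlt ltnS => /orP[/eqP|] cn; by [right|left].
by case=> -[Wc cn]; split=> //; [exact: ltnW|rewrite cn].
Qed.

Lemma finite_W_le n : finite_set (W_le n).
Proof.
elim: n => [|n IH]; last by rewrite W_leS finite_setU; split=> //; exact: finite_W_eq.
suff -> : W_le 0 = W_eq 0 by exact: finite_W_eq.
by apply/seteqP; split=> c [Wc] cn; split=> //; [apply/eqP; rewrite -leqn0|rewrite cn].
Qed.

Lemma set_card_W_leS n :
  set_card (W_le n.+1) = (set_card (W_le n) + set_card (W_eq n.+1))%N.
Proof.
rewrite /set_card W_leS fset_setU ?finmap.cardfsUI; try exact: finite_W_le || exact: finite_W_eq.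
rewrite -finmap.cardfsUI -fset_setI; try exact: finite_W_le || exact: finite_W_eq.
suff -> : (W_le n `&` W_eq n.+1 = classical_sets.set0)%classic.
  by rewrite fset_set0 finmap.cardfs0 addn0.
by apply/seteqP; split=> // c [[_ cn] [_ E]]; move: cn; rewrite E ltnn.
Qed.

(** * Counting necklaces *)

(** Equal fibres put the two images in bijection. This turns the count of conjugacy classes into a
    count of orbits. *)
Lemma set_card_range (T V : finType) (U : choiceType) (F : T -> U) (h : T -> V) :
  (forall x y, F x = F y <-> h x = h y) ->
  set_card (range F) = #|[set h x | x in [set: T]]|.
Proof.
move=> Fh.
have [x0|T0] := pickP [pred x : T | true]; last first.
  have -> : range F = classical_sets.set0.
    by apply/seteqP; split=> // _ [x _ <-]; have := T0 x.
  rewrite /set_card fset_set0 cardfs0; apply/esym/eqP; rewrite cards_eq0.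
  by apply/eqP/setP => v; rewrite inE; apply/imsetP => -[x]; have := T0 x.
pose g v := F (odflt x0 [pick x | h x == v]).
have gh x : g (h x) = F x.
  rewrite /g; case: pickP => [y /eqP /Fh //|/(_ x)]; by rewrite eqxx.
rewrite /set_card.
suff -> : fset_set (range F) = [fset g v | v in [set h x | x in [set: T]]]%fset.
  rewrite card_in_imfset /= -?cardE // => _ _ /imsetP[x _ ->] /imsetP[y _ ->].
  by rewrite !gh => /Fh.
apply/fsetP => c; rewrite in_fset_set; last exact: finite_image.
apply/idP/imfsetP => [/set_mem[x _ <-]|[_ /imsetP[x _ ->] ->]].
  by exists (h x); rewrite ?gh //=; apply/imsetP; exists x; rewrite ?inE.
by apply/mem_set; exists x; rewrite ?gh.
Qed.

Section Necklaces.
Variable n : nat.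
Local Notation t := n.+1.

(** The length is a successor so that ['I_t] is the cyclic group of order t. *)
Definition tuple_rot (e : t.-tuple bool) (a : 'I_t) : t.-tuple bool :=
  [tuple of rot a e].

Lemma nth_tuple_rot e a i : (i < t)%N ->
  nth true (tuple_rot e a) i = nth true e ((i + a) %% t)%N.
Proof.
by move=> it; rewrite nth_rot_mod size_tuple // ltnW.
Qed.

Lemma tuple_rot1 : tuple_rot^~ 1%g =1 id.
Proof. by move=> e; apply/val_inj; rewrite /= rot0. Qed.

Lemma tuple_rotM e : act_morph tuple_rot e.
Proof.
move=> a b; apply/val_inj/(@eq_from_nth _ true); rewrite ?size_tuple // => i it.
rewrite !nth_tuple_rot ?ltn_mod // modnDmr modnDml addnA.
by rewrite addnAC.
Qed.

Definition tuple_rot_action := TotalAction tuple_rot1 tuple_rotM.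

(** Modulo t, the multiples of [a] are those of the gcd, so a fixed tuple repeats its first
    [gcdn a t] letters. *)
Lemma tuple_rot_fixedP (e : t.-tuple bool) (a : 'I_t) :
  reflect (exists u : (gcdn a t).-tuple bool,
             e = [tuple nth true u (i %% gcdn a t) | i < t])
          (tuple_rot e a == e).
Proof.
have g0 : (0 < gcdn a t)%N by rewrite gcdn_gt0 orbT.
have nthE (u : seq bool) i : (i < t)%N ->
    nth true [tuple nth true u (i %% gcdn a t) | i < t] i = nth true u (i %% gcdn a t).
  by move=> it; rewrite -[i]/(val (Ordinal it)) -tnth_nth tnth_mktuple.
apply: (iffP eqP) => [ea|[u ->]]; last first.
  apply/val_inj/(@eq_from_nth _ true); rewrite ?size_tuple // => i it.
  rewrite nth_tuple_rot // !nthE ?ltn_mod //.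
  rewrite modn_dvdm ?dvdn_gcdr // -modnDmr.
  by have /eqP -> := dvdn_gcdl a t; rewrite addn0.
have step k i : nth true e ((i + k * a) %% t) = nth true e (i %% t).
  elim: k => [|k IH]; first by rewrite addn0.
  rewrite -IH -[in RHS]ea nth_tuple_rot ?ltn_mod // modnDml.
  by congr (nth _ _ (_ %% _)); lia.
(* [t] divides [gcdn t a + c * a]: a shift by the gcd and then [c] shifts by [a] make whole
   turns. *)
have [c _ tc] := @Bezoutl t a isT.
have stepg i : nth true e ((i + gcdn a t) %% t) = nth true e (i %% t).
  rewrite -(step c) -addnA gcdnC -modnDmr.
  by have /eqP -> := tc; rewrite addn0.
have stepm m i : nth true e ((i + m * gcdn a t) %% t) = nth true e (i %% t).
  elim: m => [|m IH]; first by rewrite addn0.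
  by rewrite -IH -[in RHS]stepg; congr (nth _ _ (_ %% _)); lia.
have gt : (gcdn a t <= t)%N by rewrite dvdn_leq ?dvdn_gcdr.
exists [tuple nth true e i | i < gcdn a t].
apply/val_inj/(@eq_from_nth _ true); rewrite ?size_tuple // => i it.
rewrite nthE //.
have ig := ltn_pmod i g0.
rewrite -[(i %% gcdn a t)%N]/(val (Ordinal ig)) -tnth_nth tnth_mktuple /=.
rewrite -[in LHS](modn_small it) {1}(divn_eq i (gcdn a t)) addnC stepm.
by rewrite modn_small // (leq_trans ig).
Qed.

Lemma card_tuple_rot_fixed (a : 'I_t) :
  #|[set e | tuple_rot e a == e]| = (2 ^ gcdn a t)%N.
Proof.
have g0 : (0 < gcdn a t)%N by rewrite gcdn_gt0 orbT.
have gt : (gcdn a t <= t)%N by rewrite dvdn_leq ?dvdn_gcdr.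
pose F (u : (gcdn a t).-tuple bool) : t.-tuple bool :=
  [tuple nth true u (i %% gcdn a t) | i < t].
have -> : [set e | tuple_rot e a == e] = [set F u | u in [set: (gcdn a t).-tuple bool]].
  apply/setP => e; rewrite inE; apply/tuple_rot_fixedP/imsetP => [[u ->]|[u _ ->]].
    by exists u; rewrite ?inE.
  by exists u.
rewrite card_imset ?cardsT ?card_tuple ?card_bool // => u v uv.
apply/eq_from_tnth => i.
have it : (i < t)%N by exact: leq_trans gt.
have := congr1 (fun w => tnth w (Ordinal it)) uv.
by rewrite !tnth_mktuple /= modn_small // -!tnth_nth.
Qed.

Lemma burnside_tuple_rot :
  (\sum_(a < t) 2 ^ gcdn a t)%N =
  (#|[set orbit tuple_rot_action [set: 'I_t] e | e in [set: t.-tuple bool]]| * t)%N.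
Proof.
have := @Frobenius_Cauchy _ _ _ tuple_rot_action [group of [set: 'I_t]] [set: t.-tuple bool].
rewrite cardsT card_ord => <-; last first.
  by apply/actsP => a _ x; rewrite !inE.
rewrite [RHS](eq_bigl xpredT); last by move=> a; rewrite inE.
apply: eq_bigr => a _; rewrite -card_tuple_rot_fixed; apply: eq_card => e.
by rewrite finset.in_setI finset.in_setT [LHS]finset.in_set; apply/eqP/afix1P.
Qed.

Lemma orbit_tuple_rot_eq (e f : t.-tuple bool) :
  orbit tuple_rot_action [set: 'I_t] e = orbit tuple_rot_action [set: 'I_t] f <->
  conj_class (ab_word e) = conj_class (ab_word f).
Proof.
split=> [/orbit_eqP /imsetP[a _ ->]|ef]; first exact: conj_class_ab_word_rot.
have [|||sz [r rt er]] := conj_class_ab_word_eq e f; rewrite ?size_tuple //.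
rewrite size_tuple in rt.
apply/orbit_eqP/imsetP; exists (Ordinal rt); first by rewrite inE.
exact/val_inj.
Qed.

End Necklaces.

Lemma card_W_eq t : (0 < t)%N ->
  (t * set_card (W_eq (2 * t)) = \sum_(1 <= j < t.+1) 2 ^ gcdn j t)%N.
Proof.
case: t => // n _; rewrite W_eq_even //.
rewrite (set_card_range _ _ _ _ _ (fun e f => iff_sym (orbit_tuple_rot_eq n e f))).
rewrite mulnC -burnside_tuple_rot big_add1 /= -(big_mkord xpredT (fun j => 2 ^ gcdn j n.+1)%N).
(* Burnside's sum starts at 0 and the goal's at 1; the terms at 0 and at t agree, as gcd(0,t) =
   gcd(t,t). *)
by rewrite big_nat_recl // big_nat_recr //= gcd0n gcdnn addnC.
Qed.

(** * Asymptotics *)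

Lemma card_W_eq_ge t : (0 < t)%N -> (2 ^ t <= t * set_card (W_eq (2 * t)))%N.
Proof.
by move=> t0; rewrite card_W_eq // big_nat_recr //= gcdnn leq_addl.
Qed.

Lemma card_W_eq_le t : (0 < t)%N ->
  (t * set_card (W_eq (2 * t)) <= 2 ^ t + t * 2 ^ t./2)%N.
Proof.
move=> t0; rewrite card_W_eq // big_nat_recr //= gcdnn addnC leq_add2l.
have -> : (t * 2 ^ t./2 = \sum_(0 <= j < t) 2 ^ t./2)%N.
  by rewrite sum_nat_const_nat subn0.
rewrite [leqRHS](big_ltn t0).
apply: leq_trans (leq_addl _ _); rewrite big_nat [leqRHS]big_nat.
apply: leq_sum => j /andP[j1 jt]; rewrite leq_exp2l //.
have /dvdnP[k tk] := dvdn_gcdr j t.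
have gj : (gcdn j t <= j)%N by rewrite dvdn_leq // dvdn_gcdl.
(* The gcd is at most j < t, so the quotient is at least 2 and the gcd at most t/2. *)
have : (1 < k)%N by move: tk gj; case: k => [|[|k]]; lia.
by move: tk; set g := gcdn j t; nia.
Qed.

Lemma sqr_le_exp2 m : (m ^ 2 <= 2 * 2 ^ m)%N.
Proof.
elim: m => // -[|[|[|m]]] //; rewrite -!mulnn [(2 ^ m.+4)%N]expnS; nia.
Qed.

(** With h and m the lower and upper halves of t, t <= 2m and 2^t = 2^m 2^h, so t^2 <= 4 m^2 <= 8
    2^m. *)
Lemma sqr_exp2_half_le t : (t * t * 2 ^ t./2 <= 8 * 2 ^ t)%N.
Proof.
have := sqr_le_exp2 (uphalf t); have := uphalf_half t; have := odd_double_half t.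
set h := t./2; set m := uphalf t => th mh sq.
have -> : (2 ^ t = 2 ^ m * 2 ^ h)%N by rewrite -expnD; congr (2 ^ _)%N; lia.
rewrite mulnA leq_mul2r; apply/orP; right.
have tm : (t <= 2 * m)%N by lia.
by move: sq; nia.
Qed.

Section Asymptotics.
Variable R : realType.

Lemma cvg_of_mul_dist (x : nat -> R) (l C : R) (n0 : nat) :
  (forall t, (n0 <= t)%N -> t%:R * `|x t - l| <= C) ->
  (x t @[t --> \oo] --> l)%classic.
Proof.
move=> H; apply/cvgrPdist_le => e e0; near=> t.
have t0 : (0 : R) < t%:R by rewrite ltr0n; near: t; exact: nbhs_infty_gt.
rewrite distrC -(ler_pM2l t0).
apply: le_trans (H t _) _; first by near: t; exact: nbhs_infty_ge.
by rewrite -ler_pdivrMr //; near: t; exact: nbhs_infty_ger.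
Unshelve. all: by end_near. Qed.

Definition ratio_eq (t : nat) : R := (set_card (W_eq (2 * t)))%:R / (2 ^+ t / t%:R).
Definition ratio_le (t : nat) : R := (set_card (W_le (2 * t)))%:R / (2 ^+ t.+1 / t%:R).

Lemma ratio_eq_bounds t : (0 < t)%N -> 0 <= ratio_eq t - 1 <= 8 / t%:R.
Proof.
move=> t0.
have tR : (0 : R) < t%:R by rewrite ltr0n.
have pR : (0 : R) < 2 ^+ t by rewrite exprn_gt0.
have qE : ratio_eq t = (t * set_card (W_eq (2 * t)))%:R / 2 ^+ t.
  by rewrite /ratio_eq natrM; field; rewrite !gt_eqF.
rewrite qE subr_ge0 ler_pdivlMr // mul1r lerBlDl ler_pdivrMr //.
rewrite -natrX ler_nat card_W_eq_ge //=.
apply: le_trans (_ : (2 ^ t + t * 2 ^ t./2)%:R <= _); first by rewrite ler_nat card_W_eq_le.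
rewrite -(ler_pM2r tR) mulrAC mulrDl mul1r divfK ?gt_eqF //.
have := sqr_exp2_half_le t; rewrite -(ler_nat R) !natrM !natrD !natrM.
nra.
Qed.

(** No class has odd length above 1, so passing from 2t to 2t+2 adds only the classes of length
    2t+2. *)
Lemma ratio_le_rec t : (0 < t)%N ->
  ratio_le t.+1 = ratio_le t * (t.+1%:R / (2 * t%:R)) + ratio_eq t.+1 / 2.
Proof.
case: t => // t _.
have E : set_card (W_le (2 * t.+2)) =
    (set_card (W_le (2 * t.+1)) + set_card (W_eq (2 * t.+2)))%N.
  have -> : (2 * t.+2 = (2 * t.+1).+2)%N by lia.
  rewrite !set_card_W_leS W_eq_odd // -[X in (_ + X + _)%N]/(#|` fset_set _|).
  by rewrite fset_set0 cardfs0 addn0.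
rewrite /ratio_le /ratio_eq E natrD !exprS.
by field; rewrite ?expf_neq0 ?pnatr_eq0 // !gt_eqF.
Qed.

(** As (t+1)/(2t) = 1/2 + 1/(2t), the limit 1 satisfies the recurrence up to 1/(2t). With half of
    the error 8/t in [ratio_eq] this makes 9/(2t), rounded up to 5/t. *)
Lemma ratio_le_dist t : (0 < t)%N ->
  `|ratio_le t.+1 - 1| <= `|ratio_le t - 1| * (t.+1%:R / (2 * t%:R)) + 5 / t%:R.
Proof.
move=> t0; have tR : (0 : R) < t%:R by rewrite ltr0n.
have /andP[q0 q8] := ratio_eq_bounds t.+1 isT.
have -> : ratio_le t.+1 - 1 = (ratio_le t - 1) * (t.+1%:R / (2 * t%:R)) +
    ((2 * t%:R)^-1 + (ratio_eq t.+1 - 1) / 2).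
  by rewrite ratio_le_rec // -[t.+1]addn1 natrD; field; rewrite gt_eqF.
apply: le_trans (ler_normD _ _) _; rewrite normrM.
have c0 : 0 <= t.+1%:R / (2 * t%:R) :> R by rewrite divr_ge0 // mulr_ge0.
rewrite (ger0_norm c0) lerD2l ger0_norm; last first.
  by rewrite addr_ge0 ?divr_ge0 // invr_ge0 mulr_ge0.
have q8' : ratio_eq t.+1 - 1 <= 8 / t%:R.
  apply: le_trans q8 _; rewrite ler_pM2l // lef_pV2 ?posrE ?ltr0n //.
  by rewrite ler_nat.
have -> : (2 * t%:R)^-1 = t%:R^-1 / 2 :> R by rewrite invfM mulrC.
have := invr_gt0 (t%:R : R); rewrite tR.
move: q8'; set i := _^-1; lra.
Qed.

Lemma ratio_le_bounded : exists C, forall t, (3 <= t)%N -> t%:R * `|ratio_le t - 1| <= C.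
Proof.
set v := fun t => t%:R * `|ratio_le t - 1|.
have v0 t : 0 <= v t by rewrite mulr_ge0.
(* From t = 3 on, (1 + 1/t)^2 / 2 <= 8/9 and 5 (1 + 1/t) <= 20/3, so a bound that is at least 60 and
   at least [v 3] persists; 90 leaves room. *)
exists (v 3%N + 90) => t; rewrite -/(v t); elim: t => // t IH.
rewrite leq_eqVlt ltnS => /orP[/eqP <-|t3]; first by rewrite lerDl.
have tR : (3 : R) <= t%:R by rewrite ler_nat.
have {}IH := IH t3.
have t0 : (0 < t)%N by lia.
have := ratio_le_dist t t0; rewrite -(ler_pM2l (ltr0Sn R t)) -/(v t.+1).
move/le_trans; apply.
have -> : t.+1%:R * (`|ratio_le t - 1| * (t.+1%:R / (2 * t%:R)) + 5 / t%:R) =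
   v t * ((1 + t%:R^-1) ^+ 2 / 2) + 5 * (1 + t%:R^-1).
  by rewrite /v -[t.+1]addn1 natrD; field; lra.
have i3 : t%:R^-1 <= 3^-1 :> R by rewrite lef_pV2 ?posrE //; lra.
have i0 : 0 <= t%:R^-1 :> R by rewrite invr_ge0.
move: (v0 t) (v0 3%N) IH i3 i0; set x := v t; set y := v 3%N; set i := _^-1.
move=> x0 y0 xy i3 i0.
have h : (1 + i) ^+ 2 / 2 <= 8 / 9 by nra.
have : x * ((1 + i) ^+ 2 / 2) <= x * (8 / 9) by rewrite ler_wpM2l.
lra.
Qed.

End Asymptotics.

Theorem theorem4p2 (R : realType) :
  [/\ forall t : nat, (0 < t)%N ->
        (set_card (W_eq (2 * t)))%:R =
          (1 / t%:R) * \sum_(1 <= j < t.+1) 2 ^+ gcdn j t :> R,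
      asymp_equiv (fun t : nat => (set_card (W_eq (2 * t)))%:R : R)
                  (fun t : nat => 2 ^+ t / t%:R)
    & asymp_equiv (fun t : nat => (set_card (W_le (2 * t)))%:R : R)
                  (fun t : nat => 2 ^+ t.+1 / t%:R)].
Proof.
split.
- move=> t t0; have tR : (t%:R : R) != 0 by rewrite pnatr_eq0 -lt0n.
  apply: (mulfI tR); rewrite mulrA mul1r divff // mul1r -natrM card_W_eq // natr_sum.
  by apply: eq_bigr => j _; rewrite natrX.
- apply: (@cvg_of_mul_dist R (ratio_eq R) 1 8 1) => t t0.
  have /andP[q0 q8] := ratio_eq_bounds R t t0.
  by rewrite ger0_norm // mulrC -ler_pdivlMr // ltr0n.
- have [C HC] := ratio_le_bounded R.
  exact: (@cvg_of_mul_dist R (ratio_le R) 1 C 3).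
Qed.
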